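(* Let $T$ independent snapshots of a zero-mean circularly symmetric complex Gaussian vector in $\mathbb{C}^M$ be observed, with covariance $$\mathbf{R}_y^{\mathrm{SC}}(\theta,\mathbf{c})=\mathbf{S}(\theta)\odot\mathbf{R}_{\mathrm{SC}}(\mathbf{c}),\qquad \mathbf{R}_{\mathrm{SC}}(\mathbf{c})=\sum_{k=0}^{M-1}c_k\mathbf{T}_k,$$ which is assumed positive definite, where $\theta$ is the real parameter of interest and $\mathbf{c}=[c_0,\dots,c_{M-1}]^T\in\mathbb{R}^M$ is an unknown nuisance parameter. Let $\mathbf{F}_{\mathrm{SC}}$ be the Fisher information matrix of $\mathbf{g}=[\theta,\mathbf{c}^T]^T$, with entries $$[\mathbf{F}_{\mathrm{SC}}]_{ij}=T\,\mathrm{Re}\Bigl\{\mathbf{s}_{g_i}^{H}\bigl((\mathbf{R}_y^{\mathrm{SC}})^{-T}\otimes(\mathbf{R}_y^{\mathrm{SC}})^{-1}\bigr)\mathbf{s}_{g_j}\Bigr\},\qquad \mathbf{s}_{g_i}=\mathrm{vec}\Bigl(\frac{\partial\mathbf{R}_y^{\mathrm{SC}}}{\partial g_i}\Bigr),$$ partitioned as $$\mathbf{F}_{\mathrm{SC}}=\begin{bmatrix}F_{\theta\theta}&\mathbf{F}_{\theta c}\\ \mathbf{F}_{c\theta}&\mathbf{F}_{cc}\end{bmatrix},\qquad F_{\theta\theta}\in\mathbb{R},\ \mathbf{F}_{cc}\in\mathbb{R}^{M\times M}.$$ Assume that $\mathbf{F}_{cc}$ and $\mathbf{F}_{\mathrm{SC}}$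 are nonsingular. Then the Cramér--Rao lower bound for $\theta$ (with $\mathbf{c}$ unknown) is $$\mathrm{CRLB}_{\mathrm{SC}}(\theta)=\bigl(F_{\theta\theta}-\mathbf{F}_{\theta c}\mathbf{F}_{cc}^{-1}\mathbf{F}_{c\theta}\bigr)^{-1}.$$
   Context: A uniform linear array has $M$ elements with spacing $d_0>0$ in wavelengths. The steering vector is $\mathbf{a}(\theta)=[1,e^{j2\pi d_0\sin\theta},\dots,e^{j2\pi(M-1)d_0\sin\theta}]^T$, and $\mathbf{S}(\theta)=\mathbf{a}(\theta)\mathbf{a}(\theta)^H$. $\mathbf{T}_0=\mathbf{I}_M$, and for $1\le k\le M-1$, $\mathbf{T}_k\in\mathbb{R}^{M\times M}$ has ones on the $\pm k$-th subdiagonals and zeros elsewhere, so $\mathbf{R}_{\mathrm{SC}}(\mathbf{c})$ is real symmetric Toeplitz. The symbol $\odot$ is the entrywise product, $\otimes$ the Kronecker product, $\mathrm{vec}$ the column-stacking operator, and $\mathbf{X}^{-T}=(\mathbf{X}^{-1})^T$. The Cramér--Rao lower bound for a component of a parameter vector is the corresponding diagonal entry of the inverse of the full Fisher information matrix; it lower-bounds the variance of any unbiased estimator of that component when all parameters are unknown. *)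

(* Defs.v *)
From mathcomp Require Import all_boot all_order all_algebra.
From mathcomp Require Import complex.
From mathcomp Require Import all_classical all_reals all_analysis.
Set Implicit Arguments.
Unset Strict Implicit.
Unset Printing Implicit Defensive.
Import Order.TTheory GRing.Theory Num.Theory.
Import numFieldNormedType.Exports.
Local Open Scope classical_set_scope.
Local Open Scope ring_scope.
Local Open Scope complex_scope.
Local Open Scope sesquilinear_scope.

Section Matrices.
Variable R : realType.

Definition hadamard m n (A B : 'M[R[i]]_(m, n)) : 'M[R[i]]_(m, n) :=
  map2_mx *%R A B.

(* mxvec lists a matrix row by row, so stacking columns is mxvec of the
   transpose: the entry (i, j) of A sits at position mxvec_index j i. *)
Definition vec m n (A : 'M[R[i]]_(m, n)) : 'cV[R[i]]_(n * m) := (mxvec A^T)^T.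

(* The pair of row indices (i, k) of A and B is sent to mxvec_index i k, that
   is, to i * p + k. *)
Definition kron m n p q (A : 'M[R[i]]_(m, n)) (B : 'M[R[i]]_(p, q)) :
    'M[R[i]]_(m * p, n * q) :=
  \matrix_(a, b) mxvec (\matrix_(i, k)
                   mxvec (\matrix_(j, l) (A i j * B k l)) 0 b) 0 a.

Definition posdef n (A : 'M[R[i]]_n) : Prop :=
  A \is hermsymmx /\
  forall w : 'cV[R[i]]_n, w != 0 -> 0 < (w ^t* *m A *m w) 0 0.

(* Real and imaginary parts are differentiated separately: R[i] has no
   canonical normed module structure over R. *)
Definition partial_mx p m n (f : 'cV[R]_p.+1 -> 'M[R[i]]_(m, n))
    (g : 'cV[R]_p.+1) (k : 'I_p.+1) : 'M[R[i]]_(m, n) :=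
  \matrix_(i, j)
    ('D_(delta_mx k 0) (fun x => complex.Re (f x i j) : R) g
     +i* 'D_(delta_mx k 0) (fun x => complex.Im (f x i j) : R) g).

End Matrices.

Section ArrayModel.
Variables (R : realType) (M : nat).

Definition expj (t : R) : R[i] := cos t +i* sin t.

Definition steering (d0 theta : R) : 'cV[R[i]]_M :=
  \col_(m < M) expj (2 * pi * m%:R * d0 * sin theta).

Definition Smx (d0 theta : R) : 'M[R[i]]_M :=
  steering d0 theta *m (steering d0 theta) ^t*.

(* For k = 0 this is the identity matrix. *)
Definition Tmx (k : nat) : 'M[R]_M :=
  \matrix_(i, j) ((i == j + k :> nat) || (j == i + k :> nat))%N%:R.

Definition RSC (c : 'cV[R]_M) : 'M[R]_M := \sum_(k < M) c k 0 *: Tmx k.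

Definition RySC (d0 theta : R) (c : 'cV[R]_M) : 'M[R[i]]_M :=
  hadamard (Smx d0 theta) (map_mx (real_complex R) (RSC c)).

Definition param (theta : R) (c : 'cV[R]_M) : 'cV[R]_(1 + M) :=
  col_mx (theta%:M : 'M[R]_1) c.

Definition RySC_param (d0 : R) (g : 'cV[R]_(1 + M)) : 'M[R[i]]_M :=
  RySC d0 (usubmx g 0 0) (dsubmx g).

End ArrayModel.

Section FisherInformation.
Variable R : realType.

(* Fisher information matrix at g of T independent zero-mean circularly
   symmetric complex Gaussian snapshots with covariance matrix C g. *)
Definition fisher_info p n (T : nat) (C : 'cV[R]_p.+1 -> 'M[R[i]]_n)
    (g : 'cV[R]_p.+1) : 'M[R]_p.+1 :=
  \matrix_(i, j) (T%:R * complex.Re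
    (((vec (partial_mx C g i)) ^t*
      *m kron (invmx (C g))^T (invmx (C g))
      *m vec (partial_mx C g j)) 0 0)).

Definition crlb p (F : 'M[R]_p) (i : 'I_p) : R := invmx F i i.

Definition FSC M (T : nat) (d0 theta : R) (c : 'cV[R]_M) : 'M[R]_(1 + M) :=
  fisher_info T (@RySC_param R M d0) (param theta c).

End FisherInformation.

Section GaussianVectors.
Variables (R : realType) (d : measure_display) (Omega : measurableType d).
Variables (P : probability Omega R) (n : nat).
Implicit Type Y : Omega -> 'cV[R[i]]_n.

Definition borel_cvec : set (set 'cV[R[i]]_n) :=
  <<s [set A : set 'cV[R[i]]_n | exists (i : 'I_n) (B : set R), measurable B /\
         (A = [set y : 'cV[R[i]]_n | B (complex.Re (y i 0))] \/
          A = [set y : 'cV[R[i]]_n | B (complex.Im (y i 0))])] >>.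

Definition random_cvec Y : Prop :=
  forall A, borel_cvec A -> measurable (Y @^-1` A).

(* Degenerate (Dirac) laws count as Gaussian; normal_prob m 0 is a junk
   value. *)
Definition gaussian_law (X : Omega -> R) : Prop :=
  exists m s : R, forall B : set R, measurable B ->
    P (X @^-1` B) = if s == 0 then \d_m B else normal_prob m s B.

Definition cexpectation (Z : Omega -> R[i]) : R[i] :=
  fine ('E_P[fun w => complex.Re (Z w)])
  +i* fine ('E_P[fun w => complex.Im (Z w)]).

Definition circular_gaussian Y (C : 'M[R[i]]_n) : Prop :=
  [/\ random_cvec Y,
      forall u : 'cV[R[i]]_n,
        gaussian_law (fun w => complex.Re ((u ^t* *m Y w) 0 0)),
      forall i, cexpectation (fun w => Y w i 0) = 0,
      forall i k, cexpectation (fun w => Y w i 0 * (Y w k 0)^*) = C i k &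
      forall (phi : R) A, borel_cvec A ->
        P [set w | A (expj phi *: Y w)] = P (Y @^-1` A)].

(* Independence over subfamilies is the case where some A t are full. *)
Definition independent_cvec (T : nat) (Y : 'I_T -> Omega -> 'cV[R[i]]_n) :
    Prop :=
  forall A : 'I_T -> set 'cV[R[i]]_n, (forall t, borel_cvec (A t)) ->
    P (\bigcap_t (Y t @^-1` A t)) = (\prod_(t < T) P (Y t @^-1` A t))%E.

End GaussianVectors.

(* Main.v *)
Require Import Defs.
From mathcomp Require Import all_boot all_order all_algebra.
From mathcomp Require Import complex.
From mathcomp Require Import all_classical all_reals all_analysis.
Import Order.TTheory GRing.Theory Num.Theory.
Import numFieldNormedType.Exports.
Local Open Scope ring_scope.

(** Block elimination. The first block column of [A *m invmx A = 1] is a linear system for the two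
    left blocks of [invmx A]; solving its lower equation with the invertible [drsubmx A] leaves the
    Schur complement times [ulsubmx (invmx A)] equal to the identity. For the Fisher matrix the
    upper left block is 1 by 1, so this is a scalar identity about the bound for [theta]. *)

Lemma schur_ulsubmx_inv (R : comUnitRingType) (m n : nat) (A : 'M[R]_(m + n)) :
  drsubmx A \in unitmx -> A \in unitmx ->
  (ulsubmx A - ursubmx A *m invmx (drsubmx A) *m dlsubmx A)
    *m ulsubmx (invmx A) = 1%:M.
Proof.
move=> uD uA; have := mulmxV uA.
rewrite -{1}[A]submxK -{1}[invmx A]submxK mulmx_block scalar_mx_block.
move=> /eq_block_mx[ul _ dl _].
(* Once substituted, [invmx (drsubmx A)] cancels [drsubmx A], and what remains is the upper equation
   [ul]. *)
have {}dl : dlsubmx A *m ulsubmx (invmx A) = - (drsubmx A *m dlsubmx (invmx A)).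
  by apply/eqP; rewrite -addr_eq0 dl.
by rewrite mulmxBl -!mulmxA dl !mulmxN mulKmx // opprK.
Qed.

Theorem lemma2 (R : realType) (M : nat) (hM : (0 < M)%N) (d0 : R) (hd0 : 0 < d0)
    (T : nat) (hT : (0 < T)%N) (theta : R) (c : 'cV[R]_M)
    (d : measure_display) (Omega : measurableType d) (P : probability Omega R)
    (y : 'I_T -> Omega -> 'cV[R[i]]_M)
    (hpos : posdef (RySC d0 theta c))
    (hgauss : forall t : 'I_T, circular_gaussian P (y t) (RySC d0 theta c))
    (hindep : independent_cvec P y)
    (hFcc : drsubmx (FSC T d0 theta c) \in unitmx)
    (hF : FSC T d0 theta c \in unitmx) :
  let F := FSC T d0 theta c in
  let Ftt := ulsubmx F 0 0 in
  let Ftc := ursubmx F in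
  let Fct := dlsubmx F in
  let Fcc := drsubmx F in
  let schur := Ftt - (Ftc *m invmx Fcc *m Fct) 0 0 in
  schur != 0 /\ crlb F (lshift M 0) = schur^-1.
Proof.
move=> F Ftt Ftc Fct Fcc schur.
have schurV : schur * crlb F (lshift M 0) = 1.
  (* Entry [0 0] of [ulsubmx (invmx F)] is the diagonal entry of [invmx F] at [lshift M 0], that is,
     the [crlb]. *)
  have /matrixP/(_ 0 0) := schur_ulsubmx_inv _ _ _ _ hFcc hF.
  rewrite [LHS]mxE big_ord1 [X in X * _]mxE [X in _ + X]mxE [X in _ * X]mxE.
  by rewrite [X in _ * X]mxE [RHS]mxE.
(* Nonvanishing comes from the product being 1. *)
have schur0 : schur != 0.
  by apply/eqP => e; move/eqP: schurV; rewrite e mul0r eq_sym oner_eq0.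
by split=> //; apply: (mulfI schur0); rewrite schurV mulfV.
Qed.
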